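(* For every integer $r\ge 2$, $$\limsup_{n\to\infty}\frac{\operatorname{cr}\left(\bigvee^{r}\overline{K_n}\right)}{\operatorname{CR}\left(\bigvee^{r}\overline{K_n}\right)}\le \zeta(r),\qquad\text{where } \zeta(r)=\frac{3(r^2-r)}{8(r^2+r-3)}.$$
   Context: $\bigvee^{r}\overline{K_n}$ denotes the balanced complete $r$-partite graph $K_{n,\dots,n}$ with $r$ partite sets, each of size $n$ (the join of $r$ copies of the complement of $K_n$). A plane drawing of a graph is a good drawing if no more than two edges intersect at any point that is not a vertex, edges incident with a common vertex do not cross, no pair of edges cross more than once, and edges that intersect at a non-vertex must cross. The crossing number $\operatorname{cr}(D)$ of a good drawing $D$ is the number of non-vertex edge intersections in $D$. For a graph $G$, the crossing number is $\operatorname{cr}(G)=\min\{\operatorname{cr}(D): D\text{ is a good drawing of } G\}$ and the maximum crossing number is $\operatorname{CR}(G)=\max\{\operatorname{cr}(D): D\text{ is a good drawing of } G\}$. *)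

(* Defs.v *)
From HB Require Import structures.
From mathcomp Require Import all_boot all_order all_algebra.
From mathcomp Require Import all_classical all_reals all_analysis.
Set Implicit Arguments.
Unset Strict Implicit.
Unset Printing Implicit Defensive.
Import Order.TTheory GRing.Theory Num.Theory.
Import numFieldNormedType.Exports.
Local Open Scope classical_set_scope.
Local Open Scope ring_scope.

Record sgraph := SGraph {
  vertex : finType;
  adj : rel vertex;
  adj_sym : symmetric adj;
  adj_irrefl : irreflexive adj }.

Definition edges (G : sgraph) : {set {set vertex G}} :=
  [set E : {set vertex G} | [exists u, exists v, adj u v && (E == [set u; v]%SET)]]%SET.

(* K_{n,...,n} with r partite sets: the vertex (i, k) is the k-th vertex of the
   i-th partite set. *)
Definition multipartite_adj (r n : nat) : rel ('I_r * 'I_n)%type :=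
  fun x y => x.1 != y.1.

Lemma multipartite_adj_sym r n : symmetric (@multipartite_adj r n).
Proof. by move=> x y; rewrite /multipartite_adj eq_sym. Qed.

Lemma multipartite_adj_irrefl r n : irreflexive (@multipartite_adj r n).
Proof. by move=> x; rewrite /multipartite_adj eqxx. Qed.

Definition balanced_multipartite (r n : nat) : sgraph :=
  SGraph (@multipartite_adj_sym r n) (@multipartite_adj_irrefl r n).

Section Drawings.
Variable R : realType.
Local Notation plane := (R * R)%type.

Definition simple_arc (a b : plane) (A : set plane) : Prop :=
  exists g : R -> plane,
    [/\ {within `[0, 1], continuous g}, {in `[0, 1] &, injective g},
        g 0 = a, g 1 = b & A = g @` `[0, 1]].

(* A and B cross at p: some homeomorphism f, with inverse g, from an open
   neighbourhood U of p onto an open neighbourhood V of the origin carries A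
   and B (within U) to the two coordinate axes (within V).  This excludes
   tangential contacts, overlaps and end-points. *)
Definition cross_at (A B : set plane) (p : plane) : Prop :=
  exists (U V : set plane) (f g : plane -> plane),
    [/\ open U, U p, open V & f p = (0, 0)] /\
    [/\ {within U, continuous f}, {within V, continuous g},
        (forall q, U q -> V (f q) /\ g (f q) = q) &
        (forall q, V q -> U (g q) /\ f (g q) = q)] /\
    (forall q, U q ->
      (A q <-> (f q).2 = 0) /\ (B q <-> (f q).1 = 0)).

Record drawing (G : sgraph) := Drawing {
  pos : vertex G -> plane;
  (* only the values on the edges of G are meaningful *)
  arc : {set vertex G} -> set plane;
  pos_inj : injective pos;
  arc_simple : forall u v, adj u v ->
    simple_arc (pos u) (pos v) (arc [set u; v]%SET);
  arc_vertex : forall E w, E \in edges G -> arc E (pos w) -> w \in E }.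

Section GoodDrawings.
Variables (G : sgraph) (D : drawing G).

Definition meet_at (E F : {set vertex G}) (p : plane) : Prop :=
  [/\ ~ range (pos D) p, arc D E p & arc D F p].

Definition edges_cross_at (E F : {set vertex G}) (p : plane) : Prop :=
  ~ range (pos D) p /\ cross_at (arc D E) (arc D F) p.

Record good_drawing : Prop := GoodDrawing {
  good_two : forall p E1 E2 E3,
    E1 \in edges G -> E2 \in edges G -> E3 \in edges G ->
    ~ range (pos D) p -> arc D E1 p -> arc D E2 p -> arc D E3 p ->
    [\/ E1 = E2, E1 = E3 | E2 = E3];
  good_incident : forall E F v p,
    E \in edges G -> F \in edges G -> E != F ->
    v \in E -> v \in F -> ~ edges_cross_at E F p;
  good_once : forall E F p q,
    E \in edges G -> F \in edges G -> E != F ->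
    edges_cross_at E F p -> edges_cross_at E F q -> p = q;
  good_cross : forall E F p,
    E \in edges G -> F \in edges G -> E != F ->
    meet_at E F p -> edges_cross_at E F p }.

Definition crossing_points : set plane :=
  [set p | exists E F, [/\ E \in edges G, F \in edges G, E != F & meet_at E F p]].

End GoodDrawings.

Definition good_crossing_counts (G : sgraph) : set nat :=
  [set k | exists D : drawing G,
     good_drawing D /\ (crossing_points D #= `I_k)%card].

(* The default value 0 is only taken when the minimum (resp. maximum) does not
   exist; see crossing_numberP and max_crossing_numberP. *)
Definition crossing_number (G : sgraph) : nat :=
  xget 0%N [set k | good_crossing_counts G k /\
                    forall j, good_crossing_counts G j -> (k <= j)%N].

Definition max_crossing_number (G : sgraph) : nat :=
  xget 0%N [set k | good_crossing_counts G k /\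
                    forall j, good_crossing_counts G j -> (j <= k)%N].

Lemma good_finite_crossings (G : sgraph) (D : drawing G) : good_drawing D ->
  exists2 k, (crossing_points D #= `I_k)%card
           & (k <= #|{: {set vertex G} * {set vertex G}}|)%N.
Proof.
move=> gD; set S := crossing_points D.
pose c (p : plane) : {set vertex G} * {set vertex G} :=
  xget (finset.set0, finset.set0) [set EF | [/\ EF.1 \in edges G, EF.2 \in edges G,
     EF.1 != EF.2 & meet_at D EF.1 EF.2 p]].
have cP p : S p -> [/\ (c p).1 \in edges G, (c p).2 \in edges G,
     (c p).1 != (c p).2 & meet_at D (c p).1 (c p).2 p].
  by move=> [E [F h]]; rewrite /c; case: xgetP => [x _ //|/(_ (E, F))].
have cI : {in S &, injective c}.
  move=> p q /set_mem Sp /set_mem Sq ceq.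
  have [e1 e2 ne mp] := cP _ Sp; have [_ _ _ mq] := cP _ Sq.
  rewrite -ceq in mq.
  by apply: (good_once gD e1 e2 ne); apply: good_cross.
have rI : {in S &, injective (fun p => (enum_rank (c p) : nat))}.
  by move=> p q Sp Sq /ord_inj/enum_rank_inj; exact: cI.
have le : (S #<= `I_(#|{: {set vertex G} * {set vertex G}}|))%card.
  rewrite -(card_le_eql (inj_card_eq rI)); apply: subset_card_le.
  by move=> _ [p _ <-] /=.
have /finite_setP[k Sk] : finite_set S.
  by apply: card_le_finite le _; exact: finite_II.
by exists k => //; move: le; rewrite (card_le_eql Sk) card_le_II.
Qed.

Lemma crossing_numberP (G : sgraph) (D : drawing G) : good_drawing D ->
  good_crossing_counts G (crossing_number G) /\
  forall j, good_crossing_counts G j -> (crossing_number G <= j)%N.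
Proof.
move=> gD; rewrite /crossing_number; case: xgetP => [//|none].
have [k Dk _] := good_finite_crossings gD.
have exk : exists k, `[< good_crossing_counts G k >].
  by exists k; apply/asboolP; exists D.
case: (ex_minnP exk) => m /asboolP mS min_m.
by case: (none m); split=> // j /asboolP; exact: min_m.
Qed.

Lemma max_crossing_numberP (G : sgraph) (D : drawing G) : good_drawing D ->
  good_crossing_counts G (max_crossing_number G) /\
  forall j, good_crossing_counts G j -> (j <= max_crossing_number G)%N.
Proof.
move=> gD; rewrite /max_crossing_number; case: xgetP => [//|none].
have [k Dk _] := good_finite_crossings gD.
have exk : exists k, `[< good_crossing_counts G k >].
  by exists k; apply/asboolP; exists D.
have ub j : `[< good_crossing_counts G j >] ->
    (j <= #|{: {set vertex G} * {set vertex G}}|)%N.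
  move=> /asboolP[D' [gD' D'j]].
  have [i D'i] := good_finite_crossings gD'.
  apply: leq_trans.
  by rewrite -card_le_II -(card_le_eql D'j) (card_le_eql D'i) card_lexx.
case: (ex_maxnP exk ub) => m /asboolP mS max_m.
by case: (none m); split=> // j /asboolP; exact: max_m.
Qed.

End Drawings.

Definition zeta (R : realType) (r : nat) : R :=
  (3 * (r%:R ^+ 2 - r%:R)) / (8 * (r%:R ^+ 2 + r%:R - 3)).

(* Main.v *)
Require Import Defs.
From mathcomp Require Import all_boot all_order all_algebra.
From mathcomp Require Import all_classical all_reals all_analysis.
From mathcomp Require Import zify ring lra.
Set Implicit Arguments.
Unset Strict Implicit.
Unset Printing Implicit Defensive.
Import Order.TTheory GRing.Theory Num.Theory.
Import numFieldNormedType.Exports.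
Local Open Scope classical_set_scope.
Local Open Scope ring_scope.

(** Both bounds come from two-page drawings: vertices lie on the x-axis and the
    edge uv is the arc y = s (x - u)(x - v), s = 1 or -1 being its page.  Two
    arcs cross, and then exactly once, iff they are on the same page and their
    end-points interleave.
    - If all edges share a page and the partite sets are consecutive intervals,
      every 4-set of vertices with no three in one partite set spans a
      crossing; there are r(r-1)(r^2+r-3)/24 n^4 - O(n^3) of those.
    - For few crossings, the partite sets are interleaved, which reduces the
      count to a two-page drawing of K_N (up to a factor (r(r-1))^2 and collisions),
      and the edge ab is put on the page f(a+b), where f is 1 on the first
      half of Z/N and -1 on the second.  The correlation of f(a+c) and f(b+d)
      over a < b < c < d factors through the middle pair b < c; summing f to
      the tent function H, it becomes ((sum H)^2 - N sum H^2) / 2 + O(N^3), so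
      that only N^4/64 + O(N^3) crossings remain. *)

(** * Positions with no three concurrent arcs *)

(* Grows so fast that the largest of six nodes dominates every polynomial
   relation that concurrency of three arcs would impose. *)
Fixpoint tau (i : nat) : int := if i is j.+1 then tau j ^+ 4 else 5.

Lemma tau_ge5 i : 5 <= tau i.
Proof.
elim: i => //= i IH.
rewrite exprS; have : 1 <= tau i ^+ 3 by apply: exprn_ege1; lia.
nia.
Qed.

Lemma tau_succ i : 4 * tau i ^+ 3 < tau i.+1.
Proof.
rewrite /= [X in _ < X]exprS; have := tau_ge5 i.
have : 1 <= tau i ^+ 3 by apply: exprn_ege1; have := tau_ge5 i; lia.
nia.
Qed.

Lemma tau_ltS i : tau i < tau i.+1.
Proof.
apply: le_lt_trans (tau_succ i); have h := tau_ge5 i; rewrite exprS.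
have : 1 <= tau i ^+ 2 by apply: exprn_ege1; lia.
nia.
Qed.

Lemma tau_lt i j : (i < j)%N -> tau i < tau j.
Proof.
elim: j => // j IH; rewrite ltnS leq_eqVlt => /orP[/eqP->|/IH h].
  exact: tau_ltS.
exact: lt_trans h (tau_ltS j).
Qed.

Lemma tau_le i j : (i <= j)%N -> tau i <= tau j.
Proof. by rewrite leq_eqVlt => /orP[/eqP->|/tau_lt/ltW]. Qed.

Lemma tau_inj : injective tau.
Proof.
move=> i j e; case: (ltngtP i j) => // /tau_lt; rewrite e ltxx //.
Qed.

Lemma prod_bounds (M x y : int) : 0 <= x <= M -> 0 <= y <= M ->
  0 <= x * y <= M * M.
Proof. by move=> /andP[x0 xM] /andP[y0 yM]; rewrite mulr_ge0 // ler_pM. Qed.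

(** The products [u * v] and [u' * v'] differ by at most [M ^+ 2 < S], so equality would force
    [u + v = u' + v'], then equal products, making [u] a root of [(X - u') * (X - v')]. *)
Lemma shifted_product_neq_center (M S u v u' v' : int) : 0 <= M -> M ^+ 2 < S ->
  0 <= u <= M -> 0 <= v <= M -> 0 <= u' <= M -> 0 <= v' <= M ->
  u != u' -> u != v' ->
  u * v - S * (u + v) != u' * v' - S * (u' + v').
Proof.
move=> M0 MS hu hv hu' hv' n1 n2; apply/eqP => e.
have := prod_bounds hu hv; have := prod_bounds hu' hv'.
rewrite -expr2 => /andP[p1 p2] /andP[p3 p4].
have e1 : S * ((u' + v') - (u + v)) = u' * v' - u * v by lia.
case: (ltgtP (u' + v') (u + v)) => h; [nia|nia|].
have /eqP : (u - u') * (u - v') = 0 by rewrite h subrr mulr0 in e1; nia.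
by rewrite mulf_eq0 !subr_eq0 (negbTE n1) (negbTE n2).
Qed.

(** Here the large number is a factor: equality reads [U * (v - s) = s * v + u' * v' - s * (u' +
    v')], whose right side is at most [2 * M ^+ 2 < U] in absolute value. *)
Lemma shifted_product_neq_factor (M U s v u' v' : int) : 0 <= M -> 2 * M ^+ 2 < U ->
  0 <= s <= M -> 0 <= v <= M -> 0 <= u' <= M -> 0 <= v' <= M ->
  v != s ->
  U * v - s * (U + v) != u' * v' - s * (u' + v').
Proof.
move=> M0 MU hs hv hu' hv' n1; apply/eqP => e.
have := prod_bounds hs hv; have := prod_bounds hs hu'; have := prod_bounds hs hv'.
have := prod_bounds hu' hv'.
rewrite -expr2 => /andP[p1 p2] /andP[p3 p4] /andP[p5 p6] /andP[p7 p8].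
have e1 : U * (v - s) = s * v + u' * v' - (s * u' + s * v') by lia.
by case: (ltgtP v s) n1 => // h _; nia.
Qed.

(** Eliminating [x] from [(x - s) * (x - T) = (x - u) * (x - v) = (x - u') * (x - v')] gives the
    relation refuted here. Its [T ^+ 2] terms cancel, leaving [T * c + d = 0] with [c != 0] and
    [|d| <= 4 * M ^+ 3 < T]. *)
Lemma concurrency_det_neq (M T s u v u' v' : int) : 0 <= M -> 4 * M ^+ 3 < T ->
  0 <= s <= M -> 0 <= u <= M -> 0 <= v <= M -> 0 <= u' <= M -> 0 <= v' <= M ->
  u * v - s * (u + v) != u' * v' - s * (u' + v') ->
  (s + T - (u + v)) * (s * T - u' * v') !=
  (s + T - (u' + v')) * (s * T - u * v).
Proof.
move=> M0 MT hs hu hv hu' hv' n1; apply/eqP => e.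
set c := (u * v - s * (u + v)) - (u' * v' - s * (u' + v')).
set d := (s - (u' + v')) * (u * v) - (s - (u + v)) * (u' * v').
have e1 : T * c + d = 0 by rewrite /c /d; move: e; nia.
have : c != 0 by rewrite /c subr_eq0.
have bd (x y z w : int) : 0 <= x <= M -> 0 <= y <= M -> 0 <= z <= M -> 0 <= w <= M ->
   - (2 * M ^+ 3) <= (s - (x + y)) * (z * w) <= 2 * M ^+ 3.
  move=> hx hy hz hw; have := prod_bounds hz hw.
  have -> : M ^+ 3 = M * (M * M) by rewrite !exprS expr0 mulr1.
  move: (M * M) (z * w) => Q q; nia.
have := bd _ _ _ _ hu hv hu' hv'; have := bd _ _ _ _ hu' hv' hu hv.
rewrite -/d => b1 b2 c0.
have : - (4 * M ^+ 3) <= d <= 4 * M ^+ 3 by rewrite /d; lia.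
move: e1 MT c0; clearbody c d; move: (M ^+ 3) => Q; nia.
Qed.

(** Supplies the nonzero coefficient of [T] in [concurrency_det_neq]: the largest of the five nodes
    is either the centre [s] or one of the factors, and each case has its own domination
    argument. *)
Lemma tau_shifted_product_neq (s u v u' v' : nat) : uniq [:: s; u; v; u'; v'] ->
  tau u * tau v - tau s * (tau u + tau v) !=
  tau u' * tau v' - tau s * (tau u' + tau v').
Proof.
rewrite /= !inE !negb_or => /and5P[/and4P[su sv su' sv']
  /and3P[uv uu' uv'] /andP[vu' vv'] u'v' _].
have [T [hT hTM]] : exists T, (T \in [:: s; u; v; u'; v']) /\
    forall i, i \in [:: s; u; v; u'; v'] -> (i <= T)%N.
  exists (\max_(i <- [:: s; u; v; u'; v']) i); split.
    by rewrite !big_cons big_nil !inE /maxn; do !case: ifP; lia.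
  by move=> i hi; apply: leq_bigmax_seq.
have bd i : i \in [:: s; u; v; u'; v'] -> i != T ->
    0 <= tau i <= tau T.-1.
  move=> /hTM h1 h2; rewrite (tau_le (_ : (i <= T.-1)%N)); last by lia.
  by have := tau_ge5 i; lia.
have T0 : (0 < T)%N.
  have := hTM s; have := hTM u; rewrite !inE !eqxx ?orbT => /(_ isT) + /(_ isT).
  by move: su; lia.
have big : 2 * tau T.-1 ^+ 2 < tau T.
  have := tau_succ T.-1; rewrite prednK //; apply: le_lt_trans.
  have := tau_ge5 T.-1; rewrite [in X in _ -> X]exprS => h.
  have : 0 <= tau T.-1 ^+ 2 by apply: sqr_ge0.
  nia.
have M0 : 0 <= tau T.-1 by have := tau_ge5 T.-1; lia.
have big' : tau T.-1 ^+ 2 < tau T.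
  apply: le_lt_trans big; have : 0 <= tau T.-1 ^+ 2 by apply: sqr_ge0.
  lia.
have ne i j : i != j -> tau i != tau j by apply: contraNneq => /tau_inj->.
have sym i j : (i != j) = (j != i) by rewrite eq_sym.
move: hT; rewrite !inE => /orP[/eqP hT|/orP[/eqP hT|/orP[/eqP hT|/orP[/eqP hT|/eqP hT]]]].
all: subst T.
- by apply: (shifted_product_neq_center M0 big'); rewrite ?bd ?ne ?inE ?eqxx ?orbT // sym.
- by apply: (shifted_product_neq_factor M0 big); rewrite ?bd ?ne ?inE ?eqxx ?orbT // sym.
- rewrite [tau u * _]mulrC [tau u + _]addrC.
  by apply: (shifted_product_neq_factor M0 big); rewrite ?bd ?ne ?inE ?eqxx ?orbT // sym.
- rewrite eq_sym.
  by apply: (shifted_product_neq_factor M0 big); rewrite ?bd ?ne ?inE ?eqxx ?orbT // sym.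
- rewrite eq_sym [tau u' * _]mulrC [tau u' + _]addrC.
  by apply: (shifted_product_neq_factor M0 big); rewrite ?bd ?ne ?inE ?eqxx ?orbT // sym.
Qed.

Definition node {R : numDomainType} (i : nat) : R := (tau i)%:~R.

Lemma node_lt {R : numDomainType} i j : (node i < node j :> R) = (i < j)%N.
Proof.
rewrite /node ltr_int; case: (ltngtP i j) => [/tau_lt->//|/tau_lt h|->].
  by rewrite ltNge (ltW h).
by rewrite ltxx.
Qed.

(** Both equations are affine in [x]; eliminating it yields the integer relation refuted by
    [concurrency_det_neq]. *)
Lemma node_nonconcurrent_top {R : numDomainType} (s T u v u' v' : nat) (x : R) :
  uniq [:: s; T; u; v; u'; v'] -> (forall i, i \in [:: s; u; v; u'; v'] -> (i < T)%N) ->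
  (x - node s) * (x - node T) = (x - node u) * (x - node v) ->
  (x - node s) * (x - node T) = (x - node u') * (x - node v') -> False.
Proof.
move=> Un hTM e1 e2.
have un5 : uniq [:: s; u; v; u'; v'].
  by move: Un => /=; rewrite !inE !negb_or -!andbA; move=> /and5P[_ -> -> -> /and5P[-> _ _ _ /and5P[_ -> -> -> /and4P[-> -> -> _]]]].
have bd i : i \in [:: s; u; v; u'; v'] -> 0 <= tau i <= tau T.-1.
  move=> /hTM h1; rewrite (tau_le (_ : (i <= T.-1)%N)); last by lia.
  by have := tau_ge5 i; lia.
have T0 : (0 < T)%N by have := hTM s; rewrite inE eqxx => /(_ isT); case: (T).
have M0 : 0 <= tau T.-1 by have := tau_ge5 T.-1; lia.
have big := tau_succ T.-1; rewrite prednK // in big.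
have := concurrency_det_neq M0 big (bd s _) (bd u _) (bd v _) (bd u' _) (bd v' _) (tau_shifted_product_neq un5).
rewrite !inE !eqxx !orbT => /(_ isT isT isT isT isT)/eqP; apply.
apply: (@intr_inj R); rewrite !(rmorphM, rmorphB, rmorphD) /= -/(node _).
rewrite -!/(node _).
move: e1 e2; move: (node s) (node T) (node u) (node v) (node u') (node v') => a b c d a' b' e1 e2.
have f1 : a * b - c * d = x * (a + b - (c + d)).
  apply/eqP; rewrite -subr_eq0; apply/eqP; transitivity ((x - a) * (x - b) - (x - c) * (x - d)); first by ring.
  by rewrite e1 subrr.
have f2 : a * b - a' * b' = x * (a + b - (a' + b')).
  apply/eqP; rewrite -subr_eq0; apply/eqP; transitivity ((x - a) * (x - b) - (x - a') * (x - b')); first by ring.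
  by rewrite e2 subrr.
rewrite f1 f2; ring.
Qed.

(** The three products are interchangeable, as are the factors of each, so the largest index may be
    moved to the second factor of the first product. *)
Lemma node_nonconcurrent {R : numDomainType} (a b c d e f : nat) (x : R) :
  uniq [:: a; b; c; d; e; f] ->
  (x - node a) * (x - node b) = (x - node c) * (x - node d) ->
  (x - node a) * (x - node b) = (x - node e) * (x - node f) -> False.
Proof.
move=> Un e1 e2.
have [T [hT hTM]] : exists T, (T \in [:: a; b; c; d; e; f]) /\
    forall i, i \in [:: a; b; c; d; e; f] -> (i <= T)%N.
  exists (\max_(i <- [:: a; b; c; d; e; f]) i); split.
    by rewrite !big_cons big_nil !inE /maxn; do !case: ifP; lia.
  by move=> i hi; apply: leq_bigmax_seq.
have key s u v u' v' : perm_eq [:: a; b; c; d; e; f] [:: s; T; u; v; u'; v'] ->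
  (x - node s) * (x - node T) = (x - node u) * (x - node v) ->
  (x - node s) * (x - node T) = (x - node u') * (x - node v') -> False.
  move=> pe; have Un' := Un; rewrite (perm_uniq pe) in Un'.
  apply: node_nonconcurrent_top => // i hi; rewrite ltn_neqAle hTM ?andbT.
    move: Un' => /= /and3P[+ + _]; rewrite inE negb_or => /andP[sT _] Ts.
    move: hi; rewrite inE => /orP[/eqP->//|hi].
    by apply: contraNneq Ts => <-.
  by rewrite (perm_mem pe); move: hi; rewrite !inE => /orP[->//|->]; rewrite !orbT.
have e3 : (x - node c) * (x - node d) = (x - node e) * (x - node f) by rewrite -e1.
have mC (y z : R) : y * z = z * y by rewrite mulrC.
move: hT; rewrite !inE => /orP[/eqP hT|/orP[/eqP hT|/orP[/eqP hT|/orP[/eqP hT|/orP[/eqP hT|/eqP hT]]]]];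
  subst T.
- apply: (key b c d e f); rewrite 1?mC //; apply/permP => p /=; lia.
- by apply: (key a c d e f).
- apply: (key d a b e f); rewrite 1?mC //; apply/permP => p /=; lia.
- apply: (key c a b e f); rewrite //; apply/permP => p /=; lia.
- apply: (key f a b c d); rewrite 1?mC //; apply/permP => p /=; lia.
- apply: (key e a b c d); rewrite //; apply/permP => p /=; lia.
Qed.

(** * Two-page drawings of complete graphs *)

(** The middle pair [b], [c] is summed outermost because the later counts split, for fixed [b] and
    [c], into independent sums over [a] and [d]. *)
Lemma card_quad_sum (T : finType) (P : T -> T -> T -> T -> bool) :
  #|[set q : T * T * T * T | let: (a, b, c, d) := q in P a b c d]%SET| =
  (\sum_b \sum_c \sum_a \sum_d P a b c d)%N.
Proof.
rewrite -sum1dep_card big_mkcond /=.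
transitivity (\sum_a \sum_b \sum_c \sum_d P a b c d)%N.
  by rewrite !pair_bigA /=; apply: eq_bigr => -[[[a b] c] d] _ /=; case: (P _ _ _ _).
by rewrite exchange_big; apply: eq_bigr => b _; rewrite exchange_big.
Qed.

(** * Finite sums over initial segments of the integers *)

Section Sums.
Variable R : realFieldType.

Lemma sum_ord_lt (n k : nat) (F : nat -> R) : (k <= n)%N ->
  \sum_(i < n) (i < k)%:R * F i = \sum_(i < k) F i.
Proof.
move=> kn; rewrite [RHS](big_ord_widen n) //= [RHS]big_mkcond /=.
by apply: eq_bigr => i _; case: (i < k)%N; rewrite ?mul1r ?mul0r.
Qed.

Lemma sum_ord_gt (n k : nat) (F : nat -> R) :
  \sum_(i < n) (k < i)%:R * F i = \sum_(k.+1 <= i < n) F i.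
Proof.
rewrite big_geq_mkord /= [RHS]big_mkcond /=.
by apply: eq_bigr => i _; case: (k < i)%N; rewrite ?mul1r ?mul0r.
Qed.

Lemma sum_periodic (n : nat) (g : nat -> R) (b : nat) :
  (forall s, g (s + n)%N = g s) -> \sum_(c < n) g (b + c)%N = \sum_(c < n) g c.
Proof.
move=> gP; elim: b => // b <-; case: n gP => [|n] gP; first by rewrite !big_ord0.
rewrite big_ord_recr [RHS]big_ord_recl /= addrC addn0 addSnnS gP; congr (_ + _).
by apply: eq_bigr => i _; rewrite addSnnS.
Qed.

Lemma sum_sqr_sub (x : R) (k : nat) : \sum_(s < k) (x - s%:R) ^+ 2 =
  k%:R * x ^+ 2 - x * (k%:R * (k%:R - 1)) + k%:R * (k%:R - 1) * (2 * k%:R - 1) / 6.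
Proof.
elim: k => [|k IH]; first by rewrite big_ord0; field.
by rewrite big_ord_recr /= IH -natr1; field.
Qed.

Lemma sum_natr (k : nat) : \sum_(s < k) s%:R = k%:R * (k%:R - 1) / 2 :> R.
Proof.
elim: k => [|k IH]; first by rewrite big_ord0; field.
by rewrite big_ord_recr /= IH -natr1; field.
Qed.

Lemma sum_pair_lt (n : nat) (T : nat -> nat -> R) : (forall b c, T b c = T c b) ->
  \sum_(b < n) \sum_(c < n) T b c =
  2 * (\sum_(b < n) \sum_(c < n) (b < c)%:R * T b c) + \sum_(b < n) T b b.
Proof.
move=> TC.
have e : \sum_(b < n) \sum_(c < n) (c < b)%:R * T b c =
         \sum_(b < n) \sum_(c < n) (b < c)%:R * T b c.
  by rewrite exchange_big; apply: eq_bigr => b _; apply: eq_bigr => c _; rewrite TC.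
rewrite mulr2n mulrDl mul1r -{2}e -!big_split /=; apply: eq_bigr => b _.
have -> : T b b = \sum_(c < n) (b == c)%:R * T b c.
  rewrite (bigD1 b) //= eqxx mul1r big1 ?addr0 // => c; rewrite eq_sym => /negbTE->.
  by rewrite mul0r.
rewrite -!big_split /=; apply: eq_bigr => c _.
by rewrite -!mulrDl -(inj_eq val_inj) /=; case: (ltngtP b c) => _; rewrite ?addr0 ?add0r mul1r.
Qed.

(** Choosing [a < b] and [d > c] shows that the left side counts the 4-subsets of an [n]-set. *)
Lemma sum_binomial_le (n : nat) :
  \sum_(b < n) \sum_(c < n) (b < c)%:R * (b%:R * (n%:R - 1 - c%:R)) <= n%:R ^+ 4 / 24 :> R.
Proof.
rewrite exchange_big /=.
have -> : \sum_(c < n) \sum_(b < n) (b < c)%:R * (b%:R * (n%:R - 1 - c%:R)) =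
    \sum_(c < n) c%:R * (c%:R - 1) / 2 * (n%:R - 1 - c%:R) :> R.
  apply: eq_bigr => c _.
  rewrite (sum_ord_lt (fun b => b%:R * (n%:R - 1 - c%:R))); last exact: ltnW.
  by rewrite -mulr_suml sum_natr.
(* The summation bound [k] is kept apart from [x], although both become [n], so that induction on
   [k] applies. *)
have E (x : R) k : \sum_(c < k) c%:R * (c%:R - 1) / 2 * (x - 1 - c%:R) =
   k%:R * (k%:R - 1) * (k%:R - 2) * (4 * x - 3 * k%:R - 3) / 24.
  elim: k => [|k IH]; first by rewrite big_ord0; field.
  by rewrite big_ord_recr /= IH -natr1; field.
rewrite E; case: n => [|n]; first by rewrite !mul0r expr0n mul0r.
rewrite ler_pM2r ?invr_gt0 ?ltr0n // -natr1; have : 0 <= n%:R :> R by [].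
move: (n%:R) => x x0.
rewrite -subr_ge0.
set y := _ - _; have -> : y = (x + 1) * (6 * x ^+ 2 + x + 1) by rewrite /y; ring.
by rewrite mulr_ge0 ?addr_ge0 // mulr_ge0 // exprn_ge0.
Qed.

End Sums.

(** * Interleaving pairs of edges on a common page under the half-period rule *)

Section PageCount.
Variables (R : realFieldType) (m : nat).
Local Notation N := (m + m)%N.

Definition page_sign (s : nat) : R := if (s %% N < m)%N then 1 else -1.
(** A tent function: it rises to [m] and returns to 0 over each period [N]. *)
Definition tent (s : nat) : R := \sum_(i < s) page_sign i.
Local Notation f := page_sign.
Local Notation H := tent.

Lemma page_sign_periodic s : f (s + N) = f s.
Proof. by rewrite /f modnDr. Qed.

Lemma tentS s : H s.+1 = H s + f s. Proof. by rewrite /H big_ord_recr. Qed.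

Lemma tent_up s : (s <= m)%N -> H s = s%:R.
Proof.
elim: s => [|s IH] sm; first by rewrite /H big_ord0.
by rewrite tentS IH ?(ltnW sm) // /f modn_small ?sm ?natr1 //; lia.
Qed.

Lemma tent_down s : (s <= m)%N -> H (m + s) = m%:R - s%:R.
Proof.
elim: s => [|s IH] sm; first by rewrite addn0 tent_up // subr0.
rewrite addnS tentS IH ?(ltnW sm) // /f modn_small; last by lia.
by rewrite ltnNge leq_addr /= -natr1; ring.
Qed.

Lemma tent_periodic s : H (s + N) = H s.
Proof.
elim: s => [|s IH]; first by rewrite add0n tent_down // subrr /H big_ord0.
by rewrite addSn !tentS IH page_sign_periodic.
Qed.

Lemma sum_page_sign j k : (j <= k)%N -> \sum_(j <= s < k) f s = H k - H j.
Proof.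
move=> jk; rewrite /H -!(big_mkord xpredT f) (@big_cat_nat _ _ _ j 0 k) //=.
by rewrite addrAC subrr add0r.
Qed.

Lemma tent_lip j k : (j <= k)%N -> `|H k - H j| <= (k - j)%:R.
Proof.
move=> jk; rewrite -sum_page_sign //; apply: le_trans (ler_norm_sum _ _ _) _.
rewrite -[X in _ <= X]mul1r mulr_natr -sumr_const_nat; apply: ler_sum => i _.
by rewrite /f; case: ifP; rewrite ?normrN normr1.
Qed.

(** The two slopes pair up: [H s + H (m + s) = m]. *)
Lemma sum_tent : \sum_(s < N) H s = m%:R ^+ 2.
Proof.
rewrite big_split_ord /= -big_split /=.
rewrite (eq_bigr (fun=> m%:R)); first by rewrite sumr_const card_ord expr2 mulr_natr.
by move=> i _; rewrite tent_up ?(ltnW (ltn_ord i)) // tent_down ?(ltnW (ltn_ord i)) // addrC subrK.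
Qed.

Lemma sum_tent_sqr : \sum_(s < N) H s ^+ 2 = (2 * m%:R ^+ 3 + m%:R) / 3.
Proof.
rewrite big_split_ord /=.
rewrite (eq_bigr (fun s : 'I_m => (0 - s%:R) ^+ 2 : R)); last first.
  by move=> i _; rewrite tent_up ?(ltnW (ltn_ord i)) // sub0r sqrrN.
rewrite [X in _ + X](eq_bigr (fun s : 'I_m => (m%:R - s%:R) ^+ 2 : R)); last first.
  by move=> i _; rewrite tent_down ?(ltnW (ltn_ord i)).
by rewrite !sum_sqr_sub; field.
Qed.

(** Up to replacing [(b + c).+1] by [b + c], this is the sum of [f (a + c) * f (b + d)] over [a < b]
    and [d > c]; the replacement makes it symmetric in [b] and [c]. *)
Let T (b c : nat) : R := (H (b + c) - H c) * (H b - H (b + c)).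

(** By periodicity, summing over a shift of [H] changes nothing. After expansion each of the three
    mixed products contributes [S1 ^+ 2], with signs +, - and +, and the square contributes
    [- N * S2]. *)
Let sum_T : \sum_(b < N) \sum_(c < N) T b c =
  (\sum_(s < N) H s) ^+ 2 - N%:R * \sum_(s < N) H s ^+ 2.
Proof.
set S1 := \sum_(s < N) H s; set S2 := \sum_(s < N) _ ^+ 2.
have h1 b : \sum_(c < N) H (b + c) = S1 by apply: sum_periodic; exact: tent_periodic.
have h2 b : \sum_(c < N) H (b + c) ^+ 2 = S2.
  by apply: (@sum_periodic _ _ (fun s => H s ^+ 2)) => s; rewrite tent_periodic.
have h3 : \sum_(b < N) \sum_(c < N) H (b + c) * H b = S1 ^+ 2.
  under eq_bigr => b _ do rewrite -mulr_suml h1.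
  by rewrite -mulr_sumr expr2.
have h4 : \sum_(b < N) \sum_(c < N) H (b + c) * H c = S1 ^+ 2.
  rewrite exchange_big -h3; apply: eq_bigr => b _; apply: eq_bigr => c _.
  by rewrite addnC.
have h5 : \sum_(b < N) \sum_(c < N) H (b + c) ^+ 2 = N%:R * S2.
  under eq_bigr => b _ do rewrite h2.
  by rewrite sumr_const card_ord mulr_natl.
have h6 : \sum_(b < N) \sum_(c < N) H b * H c = S1 ^+ 2.
  under eq_bigr => b _ do rewrite -mulr_sumr.
  by rewrite -mulr_suml expr2.
transitivity (\sum_(b < N) \sum_(c < N) H (b + c) * H b - \sum_(b < N) \sum_(c < N) H (b + c) ^+ 2
  - \sum_(b < N) \sum_(c < N) H b * H c + \sum_(b < N) \sum_(c < N) H (b + c) * H c); last first.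
  by rewrite h3 h4 h5 h6; ring.
rewrite -!(sumrB, big_split) /=; apply: eq_bigr => b _.
rewrite -!(sumrB, big_split) /=; apply: eq_bigr => c _.
by rewrite /T; ring.
Qed.

Definition page_quads : {set 'I_N * 'I_N * 'I_N * 'I_N} :=
  [set q : 'I_N * 'I_N * 'I_N * 'I_N | let: (a, b, c, d) := q in
    [&& (a < b)%N, (b < c)%N, (c < d)%N & ((a + c) %% N < m)%N == ((b + d) %% N < m)%N]]%SET.

(** The summand is the indicator of equal pages: its constant part counts the pairs [(a, d)], and
    its correlation part is a product of two sums of [f]. *)
Let inner (b c : nat) : (b < c)%N -> (c < N)%N ->
  \sum_(a < b) \sum_(c.+1 <= d < N) (1 + f (a + c) * f (b + d)) / 2 =
  (b%:R * (N%:R - 1 - c%:R) + (H (b + c) - H c) * (H b - H (b + c).+1)) / 2.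
Proof.
move=> bc cN; under eq_bigr => a _ do rewrite -mulr_suml.
rewrite -mulr_suml; congr (_ / 2).
have e1 : \sum_(a < b) f (a + c) = H (b + c) - H c.
  rewrite -(big_mkord xpredT (fun a => f (a + c))) -{1}(addnK c b).
  rewrite -(big_addn 0 (b + c) c xpredT f) add0n.
  by rewrite sum_page_sign ?leq_addl.
(* The sum ends at [H (b + N)], which periodicity turns into [H b]. *)
have e2 : \sum_(c.+1 <= d < N) f (b + d) = H b - H (b + c).+1.
  under eq_bigr => d _ do rewrite addnC.
  rewrite -{1}(addnK b N) -(big_addn c.+1 (N + b) b xpredT f) addSn [(c + b)%N]addnC [(_ + b)%N]addnC.
  by rewrite sum_page_sign ?tent_periodic //; lia.
under eq_bigr => a _.
  rewrite big_split /= sumr_const_nat -mulr_sumr e2; over.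
rewrite big_split /= -mulr_suml e1 sumr_const card_ord; congr (_ + _).
by rewrite -[X in _ = _ * X]addrA -opprD nat1r -natrB // mulr_natl.
Qed.

(** With [N = 2 m], the pair count contributes [2 m^4 / 3] and the correlation [- m^4 / 6]; half
    their sum is [m^4 / 4]. The error is [(4 + 8) / 2] times [m^3]: 4 from half the diagonal of [T],
    8 from the shift by one. *)
Lemma page_quads_bound : #|page_quads|%:R <= m%:R ^+ 4 / 4 + 6 * m%:R ^+ 3 :> R.
Proof.
rewrite /page_quads card_quad_sum.
have -> : (\sum_(b < N) \sum_(c < N) \sum_(a < N) \sum_(d < N)
   [&& (a < b)%N, (b < c)%N, (c < d)%N & ((a + c) %% N < m)%N == ((b + d) %% N < m)%N])%N%:R =
  \sum_(b < N) \sum_(c < N) (b < c)%:R *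
  ((b%:R * (N%:R - 1 - c%:R) + (H (b + c) - H c) * (H b - H (b + c).+1)) / 2) :> R.
  rewrite natr_sum; apply: eq_bigr => b _; rewrite natr_sum; apply: eq_bigr => c _.
  case: (ltnP b c) => bc; last first.
    rewrite mul0r natr_sum big1 // => a _; rewrite natr_sum big1 // => d _.
    by rewrite andbF.
  rewrite mul1r -inner // -(sum_ord_lt (n := N)
     (fun a => \sum_(c.+1 <= d < N) (1 + f (a + c) * f (b + d)) / 2)); last exact: ltnW.
  rewrite natr_sum; apply: eq_bigr => a _.
  rewrite -sum_ord_gt mulr_sumr natr_sum; apply: eq_bigr => d _; rewrite /f.
  case: (a < b)%N; rewrite ?mul0r // ?mul1r /=.
  case: (c < d)%N; rewrite ?mul0r // ?mul1r /=.
  case: (_ < m)%N; case: (_ < m)%N => /=; by field.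
have TC b c : T b c = T c b by rewrite /T [(c + b)%N]addnC; ring.
have diag : - N%:R ^+ 3 <= \sum_(b < N) T b b.
  have -> : - N%:R ^+ 3 = \sum_(b < N) - N%:R ^+ 2 :> R.
    by rewrite sumr_const card_ord -[RHS]mulr_natl; ring.
  apply: ler_sum => b _; rewrite /T.
  have -> : (H (b + b) - H b) * (H b - H (b + b)) = - (H (b + b) - H b) ^+ 2 by ring.
  rewrite lerN2 -real_normK ?num_real // ler_pXn2r ?nnegrE //.
  by apply: le_trans (tent_lip _) _; rewrite ?leq_addr // ler_nat; have := ltn_ord b; lia.
have := sum_pair_lt N TC; rewrite sum_T sum_tent sum_tent_sqr.
set W := \sum_(b < N) \sum_(c < N) (b < c)%:R * T b c => WE.
(* Replacing [H (b + c).+1] by [H (b + c)] changes each term by a sign times [H (b + c) - H c],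
   hence by at most [N]. *)
have le1 : \sum_(b < N) \sum_(c < N) (b < c)%:R *
    ((b%:R * (N%:R - 1 - c%:R) + (H (b + c) - H c) * (H b - H (b + c).+1)) / 2) <=
  (\sum_(b < N) \sum_(c < N) (b < c)%:R * (b%:R * (N%:R - 1 - c%:R)) + W +
   \sum_(b < N) \sum_(c < N) N%:R) / 2 :> R.
  rewrite /W -!big_split mulr_suml /=; apply: ler_sum => b _.
  rewrite -!big_split mulr_suml /=; apply: ler_sum => c _.
  case: (b < c)%N; rewrite ?mul0r ?mul1r ?add0r ?divr_ge0 // ler_pM2r ?invr_gt0 ?ltr0n //.
  rewrite -addrA lerD2l tentS /T.
  have hc : `|H (b + c) - H c| <= N%:R.
    apply: le_trans (tent_lip _) _; rewrite ?leq_addl // ler_nat.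
    by have := ltn_ord b; lia.
  move: hc; rewrite ler_norml => /andP[h1 h2].
  by rewrite /f; case: ifP => _; lra.
apply: le_trans le1 _; have := sum_binomial_le R N.
have -> : \sum_(b < N) \sum_(c < N) N%:R = N%:R ^+ 3 :> R.
  by rewrite !sumr_const !card_ord; ring.
move: WE diag; rewrite natrD; set B := \sum_(b < N) \sum_(c < N) _.
have : 0 <= m%:R :> R by [].
move: (\sum_(b < N) T b b) (m%:R) => D x x0 WE dg hB.
have {}WE : W = (x ^+ 4 - (x + x) * ((2 * x ^+ 3 + x) / 3) - D) / 2.
  rewrite -[X in X - _ - _](_ : (x ^+ 2) ^+ 2 = _) ?WE; first by field.
  by rewrite -exprM.
have x2 : 0 <= x ^+ 2 by exact: exprn_ge0.
have e4 : (x + x) ^+ 4 / 24 = 2 * x ^+ 4 / 3 by field.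
have e3 : (x + x) ^+ 3 = 8 * x ^+ 3 by ring.
rewrite e3 in dg *; rewrite e4 in hB.
have e5 : (x + x) * ((2 * x ^+ 3 + x) / 3) = (4 * x ^+ 4 + 2 * x ^+ 2) / 3 by field.
rewrite e5 in WE; lra.
Qed.

End PageCount.

(** * Parabolic arcs *)

Section ParabolicArc.
Variable R : realType.
Local Notation plane := (R * R)%type.
Implicit Types (a b c d s x : R) (p q : plane).

(** The sign condition puts [p.1] between [a] and [b] whatever their order, so the arc is symmetric
    in its end-points. *)
Definition parabolic_arc s a b : set plane :=
  [set p | (p.1 - a) * (p.1 - b) <= 0 /\ p.2 = s * ((p.1 - a) * (p.1 - b))].

Lemma parabolic_arcC s a b : parabolic_arc s a b = parabolic_arc s b a.
Proof. by rewrite /parabolic_arc; apply/seteqP; split=> p /=; rewrite mulrC. Qed.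

Lemma continuous_pair (S T U : topologicalType) (f : S -> T) (g : S -> U) :
  continuous f -> continuous g -> continuous (fun u : S => (f u, g u)).
Proof. by move=> cf cg u; exact: (cvg_pair (cf u) (cg u)). Qed.

Lemma continuous_parabola (T : topologicalType) (f : T -> R) s a b :
  continuous f -> continuous (fun u : T => s * ((f u - a) * (f u - b))).
Proof.
move=> cf u; apply: cvgM; first exact: cvg_cst.
by apply: cvgM; apply: cvgB; try exact: cf; exact: cvg_cst.
Qed.

Lemma simple_parabolic_arc s a b : a != b ->
  simple_arc (a, 0) (b, 0) (parabolic_arc s a b).
Proof.
move=> ab; have ba : b - a != 0 by rewrite subr_eq0 eq_sym.
pose X (l : R) := a + l * (b - a).
exists (fun l => (X l, s * ((X l - a) * (X l - b)))).
have cX : continuous X.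
  move=> l; rewrite /X; apply: cvgD; first exact: cvg_cst.
  by apply: cvgM; [exact: cvg_id|exact: cvg_cst].
split.
- apply: continuous_subspaceT; apply: continuous_pair => //.
  exact: continuous_parabola.
- by move=> l l' _ _ [/addrI /(mulIf ba)].
- by rewrite /X mul0r addr0 subrr mul0r mulr0.
- by rewrite /X mul1r subrKC subrr !mulr0.
- apply/seteqP; split=> [[x y] [/= h /= ->]|_ [l /= + <-]].
    exists ((x - a) / (b - a)); last by rewrite /X divfK // subrKC.
    rewrite /= in_itv /=; have ba2 : 0 < (b - a) ^+ 2 by rewrite exprn_even_gt0.
    set l := _ / _; have e : l * (b - a) = x - a by rewrite divfK.
    have : l * (l - 1) <= 0.
      rewrite -(pmulr_lle0 _ ba2); apply: le_trans h; rewrite -e.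
      have -> : x - b = l * (b - a) - (b - a) by rewrite e; ring.
      by rewrite le_eqVlt; apply/orP; left; apply/eqP; ring.
    by move=> h'; apply/andP; split; nra.
  rewrite in_itv /= => /andP[l0 l1]; split=> //=.
  have -> : (X l - a) * (X l - b) = - (l * (1 - l)) * (b - a) ^+ 2 by rewrite /X; ring.
  have := sqr_ge0 (b - a); have : 0 <= l * (1 - l) by nra.
  nra.
Qed.

Lemma open_strip a b : open [set p : plane | (p.1 - a) * (p.1 - b) < 0].
Proof.
have -> : [set p : plane | (p.1 - a) * (p.1 - b) < 0] =
  (fun p : plane => (p.1 - a) * (p.1 - b)) @^-1` [set y | y < 0] by [].
apply: open_comp; last exact: open_lt.
move=> p _; apply: cvgM; apply: cvgB; try exact: cvg_fst; exact: cvg_cst.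
Qed.

(* Two unit parabolas with vertical axis differ by an affine function of x, so
   (x, y) |-> (y - Q x, y - P x) is a homeomorphism of the whole plane. *)
Lemma parabolic_arc_cross s a b c d p : s * s = 1 -> a + c != b + d ->
  (p.1 - a) * (p.1 - c) < 0 -> (p.1 - b) * (p.1 - d) < 0 ->
  parabolic_arc s a c p -> parabolic_arc s b d p ->
  cross_at (parabolic_arc s a c) (parabolic_arc s b d) p.
Proof.
move=> ss ne pac pbd [_ pA] [_ pB].
pose P x := s * ((x - a) * (x - c)); pose Q x := s * ((x - b) * (x - d)).
pose al := (b + d) - (a + c).
have al0 : al != 0 by rewrite subr_eq0 eq_sym.
(* [X] inverts the affine function [P - Q], which recovers the abscissa from the two coordinates of
   [f]. *)
pose X q := (s * (q.1 - q.2) - (a * c - b * d)) / al.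
(* Over this intersection of strips the sign conditions of both arcs hold, so each arc is cut out by
   its equation alone. *)
pose U : set plane := [set q | (q.1 - a) * (q.1 - c) < 0] `&` [set q | (q.1 - b) * (q.1 - d) < 0].
pose f q : plane := (q.2 - Q q.1, q.2 - P q.1).
pose g q : plane := (X q, q.2 + P (X q)).
have oU : open U by apply: openI; exact: open_strip.
have cf : continuous f.
  have c1 : continuous (fun q : plane => q.1) by move=> q; exact: cvg_fst.
  have cP := @continuous_parabola _ _ s a c c1.
  have cQ := @continuous_parabola _ _ s b d c1.
  by apply: continuous_pair => q; apply: cvgB; try exact: cvg_snd; [exact: cQ|exact: cP].
have cX : continuous X.
  move=> q; rewrite /X; apply: cvgM; last exact: cvg_cst.
  apply: cvgB; last exact: cvg_cst.
  apply: cvgM; first exact: cvg_cst.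
  by apply: cvgB; [exact: cvg_fst|exact: cvg_snd].
have cg : continuous g.
  apply: continuous_pair => // q.
  by apply: cvgD; [exact: cvg_snd|exact: continuous_parabola].
have Xf q : X (f q) = q.1.
  rewrite /X /f /=; apply: (mulIf al0); rewrite divfK // /P /Q.
  have -> : s * (q.2 - s * ((q.1 - b) * (q.1 - d)) - (q.2 - s * ((q.1 - a) * (q.1 - c))))
    = (s * s) * ((q.1 - a) * (q.1 - c) - (q.1 - b) * (q.1 - d)) by ring.
  by rewrite ss /al; ring.
have PQX q : P (X q) - Q (X q) = q.1 - q.2.
  have -> : P (X q) - Q (X q) = s * (X q * al + (a * c - b * d)) by rewrite /P /Q /al; ring.
  by rewrite /X divfK // subrK mulrA ss mul1r.
have gf q : g (f q) = q by rewrite /g Xf /f /= subrK -surjective_pairing.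
have fg q : f (g q) = q.
  rewrite /f /g /= [RHS]surjective_pairing; congr pair; last by rewrite addrK.
  by rewrite -addrA PQX addrC subrK.
exists U, (g @^-1` U), f, g; split; [split=> //|split; [split|]].
- by apply: open_comp => // q _; exact: cg.
- by rewrite /f /P /Q -pA -pB !subrr.
- exact: continuous_subspaceT.
- exact: continuous_subspaceT.
- by move=> q Uq; rewrite gf /= gf.
- by move=> q Vq; rewrite fg.
- move=> q [/= q1 q2]; rewrite /parabolic_arc /= (ltW q1) (ltW q2) -/(P _) -/(Q _).
  split; split=> [[_ ->]|/eqP]; rewrite ?subrr //; rewrite subr_eq0 => /eqP; by split.
Qed.

End ParabolicArc.

Lemma set2_eq (T : finType) (a b c d : T) : [set a; b]%SET = [set c; d]%SET ->
  (a = c /\ b = d) \/ (a = d /\ b = c).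
Proof.
move=> e; have ha : a \in [set c; d]%SET by rewrite -e set21.
have hb : b \in [set c; d]%SET by rewrite -e set22.
have hc : c \in [set a; b]%SET by rewrite e set21.
have hd : d \in [set a; b]%SET by rewrite e set22.
move: ha hb hc hd; rewrite !inE.
by move=> /orP[]/eqP ? /orP[]/eqP ? /orP[]/eqP ? /orP[]/eqP ?; subst; auto.
Qed.

Lemma card_eq_imset (T : finType) (U : Type) (A : {set T}) (f : T -> U) :
  {in A &, injective f} -> (f @` [set` A] #= `I_#|A|)%card.
Proof.
move=> fI.
have fI' : {in [set` A] &, injective f}.
  by move=> x y /set_mem xA /set_mem yA; exact: fI.
apply: card_eq_trans (inj_card_eq fI') _.
have eI : {in [set` A] &, injective (fun x => index x (enum A))}.
  by move=> x y /set_mem xA /set_mem yA; apply: (index_inj x); rewrite mem_enum.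
rewrite -(card_eql (inj_card_eq eI)).
suff -> : [set index x (enum A) | x in [set` A]] = `I_#|A| by exact: card_eqxx.
apply/seteqP; split=> [_ [x /= xA <-]|k /= kA].
  by rewrite cardE index_mem mem_enum.
rewrite cardE in kA; case: (enum A) (enum_uniq A) (fun x => mem_enum A x) kA => // x0 s us ms kA.
exists (nth x0 (x0 :: s) k); last by rewrite index_uniq.
by rewrite /= -ms mem_nth.
Qed.

(** * Two-page drawings of an arbitrary graph and their crossings *)

Section TwoPage.
Variables (R : realType) (G : sgraph).
Variables (idx : vertex G -> nat) (page : {set vertex G} -> bool).
Hypothesis idxI : injective idx.
Local Notation V := (vertex G).
Local Notation plane := (R * R)%type.
Local Notation t := (fun v : V => node (idx v) : R).
Local Notation sg E := ((-1) ^+ page E : R).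
Implicit Types (a b c d u v : V) (E F : {set V}) (p q : plane).

Let tI : injective t.
Proof.
move=> u v e; apply: idxI; case: (ltngtP (idx u) (idx v)) => //;
  by rewrite -(@node_lt R) e ltxx.
Qed.

(** An edge is an unordered pair, so its arc is described through an orientation; [parabolic_arcC]
    makes the choice irrelevant. *)
Definition page_arc E : set plane := [set p | exists u v,
  [/\ adj u v, E = [set u; v]%SET & parabolic_arc (sg E) (t u) (t v) p]].

Lemma page_arcE u v : adj u v ->
  page_arc [set u; v]%SET = parabolic_arc (sg [set u; v]%SET) (t u) (t v).
Proof.
move=> uv; apply/seteqP; split=> [p [u' [v' [_ /set2_eq[[<- <-]|[<- <-]]]]]|p h] //.
  by rewrite parabolic_arcC.
by exists u, v.
Qed.

Let pos0 v : plane := (t v, 0).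

Let pos0_inj : injective pos0.
Proof. by move=> u v [/tI]. Qed.

Lemma adj_neq u v : adj u v -> u != v.
Proof. by apply: contraTneq => ->; rewrite adj_irrefl. Qed.

Lemma page_arc_simple u v : adj u v ->
  simple_arc (pos0 u) (pos0 v) (page_arc [set u; v]%SET).
Proof.
move=> uv; rewrite page_arcE //; apply: simple_parabolic_arc.
by rewrite (inj_eq tI) adj_neq.
Qed.

Lemma sg_neq0 E : sg E != 0. Proof. by rewrite signr_eq0. Qed.

Lemma page_arc_vertex E w : E \in edges G -> page_arc E (pos0 w) -> w \in E.
Proof.
move=> _ [u [v [_ -> [_ /= /esym/eqP]]]].
rewrite !mulf_eq0 (negbTE (sg_neq0 _)) /= !subr_eq0 !(inj_eq tI).
by rewrite !inE.
Qed.

Definition two_page_drawing : drawing R G :=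
  Drawing pos0_inj page_arc_simple page_arc_vertex.
Local Notation D := two_page_drawing.

Lemma edgesP E : E \in edges G ->
  exists u v, [/\ adj u v, E = [set u; v]%SET & (idx u < idx v)%N].
Proof.
rewrite inE => /existsP[u /existsP[v /andP[uv /eqP->]]].
case: (ltngtP (idx u) (idx v)) => [h|h|/idxI e].
- by exists u, v.
- by exists v, u; rewrite adj_sym finset.setUC.
- by rewrite e adj_irrefl in uv.
Qed.

Lemma mem_edges u v : adj u v -> [set u; v]%SET \in edges G.
Proof. by move=> uv; rewrite inE; apply/existsP; exists u; apply/existsP; exists v; rewrite uv eqxx. Qed.

Lemma arc_interior a c p : adj a c -> ~ range (pos D) p ->
  Defs.arc D [set a; c]%SET p -> (p.1 - t a) * (p.1 - t c) < 0.
Proof.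
move=> ac np; rewrite /= page_arcE // => -[h1 h2].
rewrite lt_neqAle h1 andbT mulf_eq0 !subr_eq0; apply/negP => /orP h.
apply: np; case: h => /eqP h; [exists a|exists c] => //; case: p h h1 h2 => x y /= -> _ ->;
by rewrite /pos0 subrr ?mul0r ?mulr0.
Qed.

(** Both quadratics are negative at an interior point, so equal ordinates force the same page. A
    shared end-point could be cancelled, making the edges equal. Equal sums would make the
    difference of the quadratics constant, hence zero at [t a], so that [a] would be [b] or [d]. *)
Lemma meet_disjoint a b c d p : adj a c -> adj b d ->
  [set a; c]%SET != [set b; d]%SET ->
  meet_at D [set a; c]%SET [set b; d]%SET p ->
  [/\ page [set a; c]%SET = page [set b; d]%SET, uniq [:: a; c; b; d],
    (p.1 - t a) * (p.1 - t c) = (p.1 - t b) * (p.1 - t d) & t a + t c != t b + t d].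
Proof.
move=> ac bd ne [np pA pB].
have := arc_interior ac np pA; have := arc_interior bd np pB.
move: pA pB; rewrite /= !page_arcE // => -[_ h1] [_]; rewrite {}h1.
set x := p.1; set A := _ * (x - t c); set B := _ * (x - t d) => h B0 A0.
have pg : page [set a; c]%SET = page [set b; d]%SET.
  by move: h; case: (page _); case: (page _) => //; rewrite ?expr0 ?expr1; lra.
have AB : A = B by rewrite pg in h; apply: mulfI h; exact: sg_neq0.
have nc y z w : (x - t y) * (x - t z) < 0 ->
    (x - t y) * (x - t z) = (x - t y) * (x - t w) -> z = w.
  move=> h0 /mulfI e; apply: tI; apply/oppr_inj/(addrI x)/e.
  by apply: contraTneq h0 => ->; rewrite mul0r ltxx.
have ac' := adj_neq ac; have bd' := adj_neq bd.
have AB' := AB; rewrite /A /B in AB' A0.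
have n1 : a != b.
  apply: contraNneq ne => e; rewrite -e in AB'; rewrite -e; by rewrite (nc _ _ _ A0 AB').
have n2 : a != d.
  apply: contraNneq ne => e; rewrite -e [RHS]mulrC in AB'; rewrite -e.
  by rewrite (nc _ _ _ A0 AB') finset.setUC.
have n3 : c != b.
  apply: contraNneq ne => e; rewrite mulrC in A0; rewrite [LHS]mulrC -e in AB'; rewrite -e.
  by rewrite (nc _ _ _ A0 AB') finset.setUC.
have n4 : c != d.
  apply: contraNneq ne => e; rewrite mulrC in A0; rewrite [LHS]mulrC -e [RHS]mulrC in AB'; rewrite -e.
  by rewrite (nc _ _ _ A0 AB').
split=> //; first by rewrite /= !inE !negb_or ac' bd' n1 n2 n3 n4.
apply: contraNneq n1 => e; have : (t a - t b) * (t a - t d) = 0.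
  transitivity (B - A + (t a - x) * (t a + t c - (t b + t d))); first by rewrite /A /B; ring.
  by rewrite AB e !subrr mulr0 addr0.
move/eqP; rewrite mulf_eq0 !subr_eq0 !(inj_eq tI) (negbTE n2) orbF.
by [].
Qed.

Lemma meet_cross E F p : E \in edges G -> F \in edges G -> E != F ->
  meet_at D E F p -> edges_cross_at D E F p.
Proof.
move=> /edgesP[a [c [ac -> _]]] /edgesP[b [d [bd -> _]]] ne m.
have [pg _ _ s0] := meet_disjoint ac bd ne m.
case: m => np pA pB; split=> //.
have hA := arc_interior ac np pA; have hB := arc_interior bd np pB.
move: pA pB; rewrite /= !page_arcE // -pg => pA pB.
by apply: parabolic_arc_cross => //; rewrite -expr2 sqrr_sign.
Qed.

Lemma cross_meet E F p : edges_cross_at D E F p -> meet_at D E F p.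
Proof.
move=> [np [U [W [f [g [[oU Up _ fp] [_ h]]]]]]].
by have [hA hB] := h p Up; split=> //; [apply/hA|apply/hB]; rewrite fp.
Qed.

(** Three edges through one point would be pairwise disjoint, giving six distinct nodes excluded by
    [node_nonconcurrent]. Two edges meet at most once because the difference of their quadratics is
    affine and nonconstant. *)
Lemma good_two_page : good_drawing D.
Proof.
split.
- move=> p E1 E2 E3 e1 e2 e3 np p1 p2 p3.
  have [->|n12] := eqVneq E1 E2; first by constructor 1.
  have [->|n13] := eqVneq E1 E3; first by constructor 2.
  have [->|n23] := eqVneq E2 E3; first by constructor 3.
  exfalso; move: e1 e2 e3 n12 n13 n23 p1 p2 p3.
  move=> /edgesP[a [b [ab -> _]]] /edgesP[c [d [cd -> _]]] /edgesP[e [f [ef -> _]]].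
  move=> n12 n13 n23 p1 p2 p3.
  have [_ u12 e12 _] := meet_disjoint ab cd n12 (And3 np p1 p2).
  have [_ u13 e13 _] := meet_disjoint ab ef n13 (And3 np p1 p3).
  have [_ u23 _ _] := meet_disjoint cd ef n23 (And3 np p2 p3).
  apply: (node_nonconcurrent _ e12 e13).
  rewrite -/(map idx [:: a; b; c; d; e; f]) (map_inj_uniq idxI).
  move: u12 u13 u23; rewrite /= !inE !negb_or -!andbA.
  move=> /and5P[h1 h2 h3 h4 /and3P[h5 h6 _]] /and5P[_ k2 k3 k4 /and3P[k5 _ _]].
  move=> /and5P[_ l2 l3 l4 /and3P[l5 l6 _]].
  by rewrite h1 h2 h3 h4 h5 h6 k2 k3 k4 k5 l2 l3 l4 l5 l6.
- move=> E F v p e1 e2 ne vE vF /cross_meet m.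
  move: e1 e2 ne vE vF m => /edgesP[a [c [ac -> _]]] /edgesP[b [d [bd -> _]]] ne vE vF m.
  have [_ + _ _] := meet_disjoint ac bd ne m.
  move: vE vF; rewrite /= !inE => /orP[/eqP<-|/eqP<-] /orP[/eqP<-|/eqP<-];
    by rewrite eqxx ?orbT ?andbF.
- move=> E F p q e1 e2 ne /cross_meet mp /cross_meet mq.
  move: e1 e2 ne mp mq => /edgesP[a [c [ac -> _]]] /edgesP[b [d [bd -> _]]] ne mp mq.
  have [_ _ hp s0] := meet_disjoint ac bd ne mp; have [_ _ hq _] := meet_disjoint ac bd ne mq.
  have e1 : p.1 = q.1.
    apply/eqP; rewrite -subr_eq0; rewrite -subr_eq0 in s0.
    have /eqP : (p.1 - q.1) * (t a + t c - (t b + t d)) = 0.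
      transitivity (((q.1 - t a) * (q.1 - t c) - (q.1 - t b) * (q.1 - t d)) - ((p.1 - t a) * (p.1 - t c) - (p.1 - t b) * (p.1 - t d))); first by ring.
      by rewrite hp hq !subrr.
    by rewrite mulf_eq0 (negbTE s0) orbF.
  case: mp mq => _ + _ [_ + _]; rewrite /= page_arcE // => -[_ h1] [_ h2].
  by rewrite [p]surjective_pairing [q]surjective_pairing h1 h2 e1.
- exact: meet_cross.
Qed.

(** Listing the end-points in increasing order makes each interleaving pair of edges on one page
    appear exactly once. *)
Definition crossing_quads : {set V * V * V * V} :=
  [set q : V * V * V * V | let: (a, b, c, d) := q in
    [&& (idx a < idx b)%N, (idx b < idx c)%N, (idx c < idx d)%N,
        adj a c, adj b d & page [set a; c]%SET == page [set b; d]%SET]]%SET.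

(** The abscissa solves [(x - t a) * (x - t c) = (x - t b) * (x - t d)], which is linear in [x]. *)
Let chord_meet a b c d : plane :=
  let x := (t b * t d - t a * t c) / (t b + t d - (t a + t c)) in
  (x, sg [set a; c]%SET * ((x - t a) * (x - t c))).

Let chord_meetP a b c d : (a, b, c, d) \in crossing_quads ->
  meet_at D [set a; c]%SET [set b; d]%SET (chord_meet a b c d).
Proof.
rewrite inE => /and5P[ab bc cd ac /andP[bd /eqP pg]].
move: ab bc cd; rewrite -!(@node_lt R) => ab bc cd.
pose al := t b + t d - (t a + t c); have al0 : 0 < al by rewrite /al; lra.
rewrite /chord_meet -/al; set x := _ / al.
have xE : x * al = t b * t d - t a * t c by rewrite divfK ?gt_eqF.
(* [(x - t b) * al = (t b - t a) * (t c - t b)] and [(t c - x) * al = (t c - t b) * (t d - t c)]. *)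
have xb : t b < x by rewrite -subr_gt0 -(pmulr_lgt0 _ al0) mulrBl xE /al; nra.
have xc : x < t c by rewrite -subr_gt0 -(pmulr_lgt0 _ al0) mulrBl xE /al; nra.
have eq : (x - t a) * (x - t c) = (x - t b) * (x - t d).
  apply/eqP; rewrite -subr_eq0; apply/eqP.
  transitivity (x * al - (t b * t d - t a * t c)); first by rewrite /al; ring.
  by rewrite xE subrr.
have neg : (x - t a) * (x - t c) < 0 by nra.
split; rewrite /= ?page_arcE //.
- move=> [v _ [e1]]; rewrite -e1 => /esym/eqP; rewrite -[_ == _]/(_ == 0).
  by rewrite mulf_eq0 (negbTE (sg_neq0 _)) e1 lt_eqF.
- by split => //=; rewrite ltW.
- by split => //=; rewrite -?pg -?eq // ltW.
Qed.

(** [chord_meet] is a bijection from quadruples to crossings: surjective after sorting the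
    end-points, injective because no three edges concur. *)
Lemma crossing_points_two_page :
  (crossing_points D #= `I_#|crossing_quads|)%card.
Proof.
pose f (q : V * V * V * V) := let: (a, b, c, d) := q in chord_meet a b c d.
have -> : crossing_points D = f @` [set` crossing_quads].
  apply/seteqP; split; last first.
    move=> _ [[[[a b] c] d] /= q <-]; have := chord_meetP q.
    move: q; rewrite inE => /and5P[ab bc cd ac /andP[bd _]] m.
    exists [set a; c]%SET, [set b; d]%SET; split; rewrite ?mem_edges //.
    apply/eqP => /set2_eq[[e _]|[_ e]]; first by rewrite e ltnn in ab.
    by rewrite e ltnn in bc.
  move=> p [E [F [/edgesP[a [c [ac -> lac]]] /edgesP[b [d [bd -> lbd]]] ne m]]].
  wlog lab : a b c d ac lac bd lbd ne m / (idx a < idx b)%N => [H|].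
    case: (ltngtP (idx a) (idx b)) => [h|h|/idxI h]; first exact: (H a b c d).
      apply: (H b a d c) => //; first by rewrite eq_sym.
      by case: m => *; split.
    by have [_ /= ] := meet_disjoint ac bd ne m; rewrite !inE h eqxx orbT.
  have [pg _ eq s0] := meet_disjoint ac bd ne m; have [np pA pB] := m.
  have hA := arc_interior ac np pA; have hB := arc_interior bd np pB.
  have q : (a, b, c, d) \in crossing_quads.
    rewrite inE ac bd pg lab eqxx !andbT /=.
    move: lab lac lbd; rewrite -!(@node_lt R) => lab lac lbd.
    have [xa xc] : t a < p.1 /\ p.1 < t c by split; nra.
    have [xb xd] : t b < p.1 /\ p.1 < t d by split; nra.
    (* [t b < t c] because [p.1] lies between them; [t c < t d] because [p.1 - t a > p.1 - t b > 0]
       while the two products agree. *)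
    apply/andP; split; nra.
  exists (a, b, c, d) => //=.
  apply: (good_once good_two_page _ _ ne); rewrite ?mem_edges //;
    apply: meet_cross; rewrite ?mem_edges //; exact: chord_meetP.
apply: card_eq_imset => -[[[a b] c] d] [[[a' b'] c'] d'] q q' /= e.
have m := chord_meetP q; have m' := chord_meetP q'; rewrite -e in m'.
move: q q'; rewrite !inE.
move=> /and5P[ab bc cd ac /andP[bd _]] /and5P[ab' bc' cd' ac' /andP[bd' _]].
have [np p1 p2] := m; have [_ p3 p4] := m'.
have two := good_two good_two_page _ _ _ np.
have ne : [set a; c]%SET <> [set b; d]%SET.
  move=> /set2_eq[[e' _]|[_ e']]; first by rewrite e' ltnn in ab.
  by rewrite e' ltnn in bc.
have sorted u v w z : (idx u < idx v)%N -> (idx w < idx z)%N ->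
    [set u; v]%SET = [set w; z]%SET -> u = w /\ v = z.
  move=> uv wz /set2_eq[//|[e1 e2]]; rewrite e1 e2 in uv.
  by have := ltn_trans uv wz; rewrite ltnn.
have lac := ltn_trans ab bc; have lbd := ltn_trans bc cd.
have lac' := ltn_trans ab' bc'; have lbd' := ltn_trans bc' cd'.
have h1 := two _ _ _ (mem_edges ac) (mem_edges bd) (mem_edges ac') p1 p2 p3.
have h2 := two _ _ _ (mem_edges ac) (mem_edges bd) (mem_edges bd') p1 p2 p4.
(* Any matching of the two pairs of chords other than the identity gives [a' = b'] or exchanges the
   chords, against [a < b] and [a' < b']. *)
case: h1 => // /sorted[] // ? ?; case: h2 => // /sorted[] // ? ?; subst => //;
  by move: ab ab'; rewrite ?ltnn // => h /(ltn_trans h); rewrite ltnn.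
Qed.

End TwoPage.

(** * Drawings of complete multipartite graphs *)

Lemma card_offdiag (T : finType) : (#|[set p : T * T | p.1 != p.2]%SET| <= #|T| * #|T|.-1)%N.
Proof.
set A := [set p | _]%SET.
have h : (#|T| <= #|~: A|)%N.
  rewrite -cardsT -(card_imset _ (_ : injective (fun x : T => (x, x)))); last by move=> x y [].
  by apply: subset_leq_card; apply/fintype.subsetP => _ /imsetP[x _ ->]; rewrite !inE negbK /=.
have := cardsC A; rewrite card_prod; move: h; move: #|~: A| #|A| #|T| => x y z; nia.
Qed.

(** * Crossings of the interleaved two-page drawing *)

Section MultipartiteCounts.
Variables (r n : nat).
Local Notation P := ('I_r * 'I_n)%type.
Local Notation G := (balanced_multipartite r n).

Definition interleaved_index (v : P) : nat := v.2 * r + v.1.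
Definition blockwise_index (v : P) : nat := v.1 * n + v.2.

Lemma interleaved_index_inj : injective interleaved_index.
Proof.
move=> [i k] [i' k']; rewrite /interleaved_index /= => e.
have r0 : (0 < r)%N := leq_ltn_trans (leq0n _) (ltn_ord i).
have := congr1 (divn^~ r) e; have := congr1 (modn^~ r) e.
rewrite /= !modnMDl !modn_small // !divnMDl // !divn_small // !addn0.
by move=> /val_inj-> /val_inj->.
Qed.

Lemma blockwise_index_inj : injective blockwise_index.
Proof.
move=> [i k] [i' k']; rewrite /blockwise_index /= => e.
have n0 : (0 < n)%N := leq_ltn_trans (leq0n _) (ltn_ord k).
have := congr1 (divn^~ n) e; have := congr1 (modn^~ n) e.
rewrite /= !modnMDl !modn_small // !divnMDl // !divn_small // !addn0.
by move=> /val_inj-> /val_inj->.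
Qed.

(** Summing over the edge as a set avoids choosing an orientation; the partite sets are ignored, so
    the page depends only on positions inside them. *)
Definition sum_page (m : nat) (E : {set P}) : bool :=
  ((\sum_(v in E) v.2) %% (m + m) < m)%N.

Lemma sum_page2 m u v : u != v ->
  sum_page m [set u; v]%SET = ((u.2 + v.2) %% (m + m) < m)%N.
Proof. by move=> uv; rewrite /sum_page big_setU1 ?inE //= big_set1. Qed.

(** [f] and [g] together recover the quadruple; the coincidence makes the second coordinate of [f q]
    redundant, which saves a factor [n]. *)
Let collision_card (f : P * P * P * P -> P) (g : P * P * P * P -> P * P * P) :
  injective (fun q => (f q, g q)) ->
  (#|[set q | (f q).2 == (g q).1.1.2]%SET| <= r ^ 4 * n ^ 3)%N.
Proof.
move=> fgI.
have hI : {in [set q | (f q).2 == (g q).1.1.2]%SET &, injective (fun q => ((f q).1, g q))}.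
  move=> q q'; rewrite !inE => /eqP h /eqP h' [e1 e2]; apply: fgI; rewrite e2.
  by rewrite [f q]surjective_pairing [f q']surjective_pairing h h' e1 e2.
rewrite -(card_in_imset hI); apply: leq_trans (max_card _) _.
by rewrite !card_prod !card_ord; apply/eq_leq; ring.
Qed.

(** Increasing indices have weakly increasing second coordinates. If these increase strictly, they
    form a page quadruple and the first coordinates form two pairs of distinct labels; otherwise two
    neighbours collide, as in [E1], [E2] or [E3]. *)
Lemma interleaved_quads_le m : (n <= m + m)%N ->
  (#|@crossing_quads G interleaved_index (sum_page m)| <=
   (r * r.-1) ^ 2 * #|page_quads m| + 3 * (r ^ 4 * n ^ 3))%N.
Proof.
move=> nm; set Q := crossing_quads _ _.
pose w := widen_ord nm.
pose Q1 := [set q : P * P * P * P | let: (a, b, c, d) := q in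
  [&& (a.2 < b.2)%N, (b.2 < c.2)%N, (c.2 < d.2)%N, a.1 != c.1, b.1 != d.1 &
     ((a.2 + c.2) %% (m + m) < m)%N == ((b.2 + d.2) %% (m + m) < m)%N]]%SET.
pose E1 := [set q : P * P * P * P | q.1.1.1.2 == q.1.1.2.2]%SET.
pose E2 := [set q : P * P * P * P | q.1.1.2.2 == q.1.2.2]%SET.
pose E3 := [set q : P * P * P * P | q.1.2.2 == q.2.2]%SET.
have sub : Q \subset (Q1 :|: (E1 :|: (E2 :|: E3)))%SET.
  apply/fintype.subsetP => -[[[a b] c] d]; rewrite !inE /=.
  case/and5P=> ab bc cd ac /andP[bd].
  have le (u v : P) : (interleaved_index u < interleaved_index v)%N -> (u.2 <= v.2)%N.
    rewrite /interleaved_index; have := ltn_ord u.1; have := ltn_ord v.1.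
    by move: (val u.1) (val v.1) (val u.2) (val v.2) => x y z t; nia.
  have neq (u v : P) : multipartite_adj u v -> u != v.
    by apply: contraTneq => ->; rewrite /multipartite_adj eqxx.
  rewrite !sum_page2 ?neq // => ->; rewrite -[a.1 != c.1]/(multipartite_adj a c) ac.
  rewrite -[b.1 != d.1]/(multipartite_adj b d) bd !andbT.
  rewrite -!(inj_eq val_inj) /=.
  by have := le _ _ ab; have := le _ _ bc; have := le _ _ cd; lia.
have c1 : (#|Q1| <= (r * r.-1) ^ 2 * #|page_quads m|)%N.
  pose A := [set p : 'I_r * 'I_r | p.1 != p.2]%SET.
  pose f (q : P * P * P * P) := let: (a, b, c, d) := q in
    (((a.1, c.1), (b.1, d.1)), (w a.2, w b.2, w c.2, w d.2)).
  have fI : injective f.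
    move=> [[[[a1 a2] [b1 b2]] [c1 c2]] [d1 d2]] [[[[a1' a2'] [b1' b2']] [c1' c2']] [d1' d2']].
    by case=> -> -> -> -> /val_inj-> /val_inj-> /val_inj-> /val_inj->.
  rewrite -(card_imset _ fI).
  apply: (@leq_trans #|finset.setX (finset.setX A A) (page_quads m)|).
    apply: subset_leq_card; apply/fintype.subsetP => _ /imsetP[[[[a b] c] d] + ->].
    by rewrite !inE /= => /and5P[-> -> -> -> /andP[-> ->]].
  rewrite !cardsX leq_mul // -mulnn leq_mul //;
  by apply: leq_trans (card_offdiag _) _; rewrite card_ord.
have e1 : (#|E1| <= r ^ 4 * n ^ 3)%N.
  apply: (@collision_card (fun q => q.1.1.1) (fun q => (q.1.1.2, q.1.2, q.2))).
  by move=> [[[a b] c] d] [[[a' b'] c'] d'] [-> -> -> ->].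
have e2 : (#|E2| <= r ^ 4 * n ^ 3)%N.
  apply: (@collision_card (fun q => q.1.1.2) (fun q => (q.1.2, q.1.1.1, q.2))).
  by move=> [[[a b] c] d] [[[a' b'] c'] d'] [-> -> -> ->].
have e3 : (#|E3| <= r ^ 4 * n ^ 3)%N.
  apply: (@collision_card (fun q => q.1.2) (fun q => (q.2, q.1.1.1, q.1.1.2))).
  by move=> [[[a b] c] d] [[[a' b'] c'] d'] [-> -> -> ->].
apply: leq_trans (subset_leq_card sub) _.
apply: leq_trans (leq_card_setU _ _) _; apply: leq_add c1 _.
apply: leq_trans (leq_card_setU _ _) _; rewrite mulSn; apply: leq_add e1 _.
apply: leq_trans (leq_card_setU _ _) _; rewrite mulSn mul1n; exact: leq_add.
Qed.

End MultipartiteCounts.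

(** * Crossings of the one-page drawing with consecutive partite sets *)

Section Dense.
Variables (R : realFieldType) (r n : nat).
Local Notation P := ('I_r * 'I_n)%type.
Local Notation G := (balanced_multipartite r n).

(** The lexicographic order with reversed arguments: [a] precedes [u]. *)
Definition before (u a : P) : bool := (a.1 < u.1)%N || ((a.1 == u.1) && (a.2 < u.2)%N).

Lemma before_index u a : before u a -> (blockwise_index a < blockwise_index u)%N.
Proof.
rewrite /blockwise_index /before -(inj_eq val_inj) /=; have := ltn_ord u.2; have := ltn_ord a.2.
by move: (val u.1) (val a.1) (val u.2) (val a.2) => x y z t; case: ltngtP => //; nia.
Qed.

Let sum_vertex (F : 'I_r -> 'I_n -> R) : \sum_(a : P) F a.1 a.2 = \sum_(i < r) \sum_(k < n) F i k.
Proof. by rewrite pair_bigA. Qed.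

Let sum_lt k (i : 'I_k) (x : R) : \sum_(j < k) (j < i)%:R * x = i%:R * x.
Proof.
by rewrite (sum_ord_lt (fun=> x)) ?(ltnW (ltn_ord _)) // sumr_const card_ord mulr_natl.
Qed.

Let sum_gt k (i : 'I_k) (x : R) : \sum_(j < k) (i < j)%:R * x = (k%:R - 1 - i%:R) * x.
Proof.
rewrite (sum_ord_gt _ _ (fun=> x)) sumr_const_nat -[LHS]mulr_natl natrB ?ltn_ord //.
by rewrite -natr1 opprD addrA addrAC.
Qed.

Let sum_eq k (i : 'I_k) (x : R) : \sum_(j < k) (j == i)%:R * x = x.
Proof.
rewrite (bigD1 i) //= eqxx mul1r big1 ?addr0 // => j /negbTE->; exact: mul0r.
Qed.

Let beforeE (u a : P) : (before u a)%:R =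
  (a.1 < u.1)%:R + (a.1 == u.1)%:R * (a.2 < u.2)%:R :> R.
Proof.
rewrite /before -(inj_eq val_inj) /=.
by case: ltngtP => _ /=; rewrite ?mul0r ?mul1r ?addr0 ?add0r.
Qed.

Lemma sum_before (u : P) : \sum_a (before u a)%:R = u.1%:R * n%:R + u.2%:R :> R.
Proof.
under eq_bigr => a _ do rewrite beforeE.
rewrite (sum_vertex (fun i k => (i < u.1)%:R + (i == u.1)%:R * (k < u.2)%:R)).
transitivity (\sum_(i < r) ((i < u.1)%:R * n%:R + (i == u.1)%:R * u.2%:R) : R).
  apply: eq_bigr => i _; rewrite big_split /= sumr_const card_ord mulr_natr -mulr_sumr.
  congr (_ + _ * _); rewrite -[RHS]mulr1 -sum_lt.
  by apply: eq_bigr => k _; rewrite mulr1.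
by rewrite big_split /= sum_lt sum_eq.
Qed.

Lemma sum_after (u : P) : \sum_a (before a u)%:R =
  (r%:R - 1 - u.1%:R) * n%:R + (n%:R - 1 - u.2%:R) :> R.
Proof.
under eq_bigr => a _ do rewrite beforeE eq_sym.
rewrite (sum_vertex (fun i k => (u.1 < i)%:R + (i == u.1)%:R * (u.2 < k)%:R)).
transitivity (\sum_(i < r) ((u.1 < i)%:R * n%:R + (i == u.1)%:R * (n%:R - 1 - u.2%:R)) : R).
  apply: eq_bigr => i _; rewrite big_split /= sumr_const card_ord mulr_natr -mulr_sumr.
  congr (_ + _ * _); rewrite -[RHS]mulr1 -sum_gt.
  by apply: eq_bigr => k _; rewrite mulr1.
by rewrite big_split /= sum_gt sum_eq.
Qed.

Lemma sum_lower_part (u : P) : \sum_(a : P) (a.1 < u.1)%:R = u.1%:R * n%:R :> R.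
Proof.
rewrite (sum_vertex (fun i _ => (i < u.1)%:R)) -sum_lt; apply: eq_bigr => i _.
by rewrite sumr_const card_ord mulr_natr.
Qed.

Lemma sum_upper_part (u : P) : \sum_(a : P) (u.1 < a.1)%:R = (r%:R - 1 - u.1%:R) * n%:R :> R.
Proof.
rewrite (sum_vertex (fun i _ => (u.1 < i)%:R)) -sum_gt; apply: eq_bigr => i _.
by rewrite sumr_const card_ord mulr_natr.
Qed.

Local Notation Q := (@crossing_quads G (@blockwise_index r n) (fun=> false)).

(** If [b] and [c] lie in different partite sets, any [a] before [b] and any [d] after [c] will do;
    if they share one, [a] is taken from a lower and [d] from a higher partite set. *)
Lemma blockwise_quads_middle : \sum_(b : P) \sum_(c : P)
    ((b.1 < c.1)%:R * ((b.1%:R * n%:R + b.2%:R) * ((r%:R - 1 - c.1%:R) * n%:R + (n%:R - 1 - c.2%:R)))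
   + (b.1 == c.1)%:R * ((b.2 < c.2)%:R * ((b.1%:R * n%:R) * ((r%:R - 1 - c.1%:R) * n%:R))))
  <= #|Q|%:R :> R.
Proof.
rewrite /crossing_quads card_quad_sum natr_sum; apply: ler_sum => b _.
rewrite natr_sum; apply: ler_sum => c _; rewrite natr_sum.
under [leRHS]eq_bigr => a _ do rewrite natr_sum.
rewrite -(inj_eq val_inj); case: ltngtP => bc /=.
- rewrite mul0r addr0 mul1r -sum_before -sum_after mulr_suml.
  apply: ler_sum => a _; rewrite mulr_sumr; apply: ler_sum => d _.
  rewrite -natrM ler_nat mulnb; case: andP => // -[ab cd].
  rewrite !before_index // ?eqxx ?andbT; last by rewrite /before bc.
  rewrite /multipartite_adj -!(inj_eq val_inj) /=.
  move: ab cd; rewrite /before -!(inj_eq val_inj) /=; lia.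
- by rewrite !mul0r addr0; do 2! (apply: sumr_ge0 => ? _).
rewrite mul0r add0r mul1r; case: (ltnP b.2 c.2) => bc2; last first.
  by rewrite mul0r; do 2! (apply: sumr_ge0 => ? _).
rewrite mul1r -sum_lower_part -sum_upper_part mulr_suml.
apply: ler_sum => a _; rewrite mulr_sumr; apply: ler_sum => d _.
rewrite -natrM ler_nat mulnb; case: andP => // -[ab cd].
rewrite !before_index // ?eqxx ?andbT; rewrite /before ?ab ?cd // -?(inj_eq val_inj) /= ?bc ?eqxx ?bc2 ?orbT //.
rewrite /multipartite_adj -!(inj_eq val_inj) /=; lia.
Qed.

Lemma blockwise_quads_ge :
  r%:R * (r%:R - 1) * (r%:R ^+ 2 + r%:R - 3) / 24 * n%:R ^+ 4 - r%:R ^+ 3 * n%:R ^+ 3 <= #|Q|%:R :> R.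
Proof.
apply: le_trans blockwise_quads_middle.
(* The number of pairs inside one partite set, and also the sum over its positions of [x] or of
   [n - 1 - x]. *)
pose t : R := n%:R * (n%:R - 1) / 2.
have -> : \sum_(b : P) \sum_(c : P)
    ((b.1 < c.1)%:R * ((b.1%:R * n%:R + b.2%:R) * ((r%:R - 1 - c.1%:R) * n%:R + (n%:R - 1 - c.2%:R)))
   + (b.1 == c.1)%:R * ((b.2 < c.2)%:R * ((b.1%:R * n%:R) * ((r%:R - 1 - c.1%:R) * n%:R)))) =
  \sum_(j < r) ((j%:R * (j%:R - 1) / 2 * n%:R ^+ 2 + j%:R * t) * ((r%:R - 1 - j%:R) * n%:R ^+ 2 + t)
     + t * (j%:R * n%:R * ((r%:R - 1 - j%:R) * n%:R))) :> R.
  rewrite -(pair_bigA _ (fun (i : 'I_r) (x : 'I_n) => \sum_(c : P)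
    ((i < c.1)%:R * ((i%:R * n%:R + x%:R) * ((r%:R - 1 - c.1%:R) * n%:R + (n%:R - 1 - c.2%:R)))
   + (i == c.1)%:R * ((x < c.2)%:R * ((i%:R * n%:R) * ((r%:R - 1 - c.1%:R) * n%:R)))))) /=.
  transitivity (\sum_(i < r) \sum_(j < r)
     ((i < j)%:R * ((i%:R * n%:R ^+ 2 + t) * ((r%:R - 1 - j%:R) * n%:R ^+ 2 + t))
      + (i == j)%:R * (t * (j%:R * n%:R * ((r%:R - 1 - j%:R) * n%:R)))) : R); last first.
    rewrite exchange_big; apply: eq_bigr => j _; rewrite big_split /= sum_eq; congr (_ + _).
    rewrite (sum_ord_lt (fun i => (i%:R * n%:R ^+ 2 + t) * _)) ?(ltnW (ltn_ord _)) //.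
    rewrite -mulr_suml big_split /= -mulr_suml sum_natr sumr_const card_ord.
    by rewrite -[t *+ _]mulr_natl.
  apply: eq_bigr => i _.
  transitivity (\sum_(x < n) \sum_(j < r) \sum_(y < n)
    ((i < j)%:R * ((i%:R * n%:R + x%:R) * ((r%:R - 1 - j%:R) * n%:R + (n%:R - 1 - y%:R)))
   + (i == j)%:R * ((x < y)%:R * ((i%:R * n%:R) * ((r%:R - 1 - j%:R) * n%:R)))) : R).
    apply: eq_bigr => x _; exact: (sum_vertex (fun (j : 'I_r) (y : 'I_n) =>
    ((i < j)%:R * ((i%:R * n%:R + x%:R) * ((r%:R - 1 - j%:R) * n%:R + (n%:R - 1 - y%:R)))
   + (i == j)%:R * ((x < y)%:R * ((i%:R * n%:R) * ((r%:R - 1 - j%:R) * n%:R)))))).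
  rewrite exchange_big; apply: eq_bigr => j _.
  under eq_bigr => x _ do rewrite big_split /= -!mulr_sumr.
  rewrite big_split /= -!mulr_sumr; congr (_ * _ + _).
    rewrite -mulr_suml !big_split /= !sumr_const !card_ord sum_natr sumrN sum_natr.
    congr (_ * _); rewrite /t; by field.
  case: (eqVneq i j) => [->|_]; last by rewrite !mul0r.
  rewrite !mul1r exchange_big /=.
  under eq_bigr => y _ do rewrite sum_lt.
  by rewrite -mulr_suml sum_natr.
have E (y x : R) k : \sum_(j < k) ((j%:R * (j%:R - 1) / 2 * y ^+ 2 + j%:R * t) * ((x - 1 - j%:R) * y ^+ 2 + t)
     + t * (j%:R * y * ((x - 1 - j%:R) * y))) =
   y ^+ 4 * (k%:R * (k%:R - 1) * (k%:R - 2) * (4 * x - 3 * k%:R - 3) / 24) +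
   y ^+ 2 * t * (k%:R * (k%:R - 1) * (k%:R - 2) / 6 + (x - 1) * (k%:R * (k%:R - 1))
            - k%:R * (k%:R - 1) * (2 * k%:R - 1) / 3) + t ^+ 2 * (k%:R * (k%:R - 1) / 2).
  elim: k => [|k IH]; first by rewrite big_ord0; field.
  by rewrite big_ord_recr /= IH -natr1; field.
rewrite E.
have r2 : r%:R <= r%:R ^+ 2 :> R by rewrite -natrX ler_nat -mulnn; case: (r) => // k; rewrite leq_pmulr.
have r0 : 0 <= r%:R :> R by []. have n0 : 0 <= n%:R :> R by [].
rewrite -subr_ge0 /t; move: r2 r0 n0; move: (r%:R) (n%:R) => x y r2 r0 n0.
set z := _ - _.
(* Isolating [x ^+ 2 - x], nonnegative because [x] stands for a natural number, makes the sign of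
   the surplus visible. *)
have -> : z = y ^+ 3 * (3 * x ^+ 3 + x ^+ 2 + (x ^+ 2 - x)) / 4 + y ^+ 2 * (x ^+ 2 - x) / 8.
  by rewrite /z; field.
have h : 0 <= x ^+ 2 - x by rewrite subr_ge0.
apply: addr_ge0; apply: divr_ge0 => //; apply: mulr_ge0; rewrite ?exprn_ge0 //.
by apply: addr_ge0 => //; apply: addr_ge0; rewrite ?mulr_ge0 ?exprn_ge0.
Qed.

End Dense.

(** * Bounds on both crossing numbers and the limit superior *)

Lemma crossing_number_two_page (R : realType) (G : sgraph) (idx : vertex G -> nat)
    (page : {set vertex G} -> bool) : injective idx ->
  (crossing_number R G <= #|crossing_quads idx page|)%N /\
  (#|crossing_quads idx page| <= max_crossing_number R G)%N.
Proof.
move=> idxI; have gD := good_two_page R page idxI.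
have k : good_crossing_counts R G #|crossing_quads idx page|.
  by exists (two_page_drawing R page idxI); split=> //; exact: crossing_points_two_page.
by split; [apply: (crossing_numberP gD).2|apply: (max_crossing_numberP gD).2].
Qed.

(** The interleaved drawing is used with [m] half of [n], rounded up. The constant 10 is 7 from the
    page quadruples plus 3 from the collisions. *)
Lemma crossing_number_multipartite_le (R : realType) (r n : nat) : (0 < n)%N ->
  (crossing_number R (balanced_multipartite r n))%:R <=
  (r%:R * (r%:R - 1)) ^+ 2 * (n%:R ^+ 4 / 64) + 10 * r%:R ^+ 4 * n%:R ^+ 3 :> R.
Proof.
move=> n0; pose m := uphalf n.
have nm : (n <= m + m)%N by rewrite /m; lia.
have [le _] := @crossing_number_two_page R (balanced_multipartite r n) _ (sum_page m) (@interleaved_index_inj r n).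
have {le} := leq_trans le (interleaved_quads_le r nm).
rewrite -(ler_nat R) => /le_trans; apply.
rewrite (_ : _%:R = (r%:R * r.-1%:R) ^+ 2 * #|page_quads m|%:R +
  3 * (r%:R ^+ 4 * n%:R ^+ 3)); last by ring.
have -> : r%:R * r.-1%:R = r%:R * (r%:R - 1) :> R.
  by case: (r) => [|k]; rewrite ?mul0r //= -natr1 addrK.
have B := page_quads_bound R m.
have m1 : 2 * m%:R <= n%:R + 1 :> R by rewrite natr1 -natrM ler_nat /m; lia.
have y1 : 1 <= n%:R :> R by rewrite ler1n.
have x0 : 0 <= m%:R :> R by [].
set s := (_ ^+ 2).
have s0 : 0 <= s by exact: sqr_ge0.
have sr : s <= r%:R ^+ 4.
  rewrite /s -[4%N]/(2 * 2)%N exprM.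
  case: (r) => [|k]; first by rewrite !mul0r expr0n expr0n.
  rewrite -natr1 addrK ler_pXn2r ?nnegrE ?mulr_ge0 ?addr_ge0 //.
  by rewrite expr2 ler_wpM2l ?addr_ge0 // lerDl.
(* As [2 m <= n + 1] and [n >= 1], the excess over [n^4 / 64] is at most [(15 / 64 + 6) n^3]. *)
have B' : #|page_quads m|%:R <= n%:R ^+ 4 / 64 + 7 * n%:R ^+ 3 :> R.
  apply: le_trans B _; move: (n%:R) (m%:R) m1 y1 x0 => y x m1 y1 x0.
  have h4 : (2 * x) ^+ 4 <= (y + 1) ^+ 4.
    by rewrite ler_pXn2r ?nnegrE //; lra.
  have h3 : (2 * x) ^+ 3 <= (y + 1) ^+ 3.
    by rewrite ler_pXn2r ?nnegrE //; lra.
  have e4 : (2 * x) ^+ 4 = 16 * x ^+ 4 by ring.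
  have e3 : (2 * x) ^+ 3 = 8 * x ^+ 3 by ring.
  have f4 : (y + 1) ^+ 4 = y ^+ 4 + 4 * y ^+ 3 + 6 * y ^+ 2 + 4 * y + 1 by ring.
  have f3 : (y + 1) ^+ 3 = y ^+ 3 + 3 * y ^+ 2 + 3 * y + 1 by ring.
  have g1 : 1 <= y ^+ 3 by rewrite exprn_ege1.
  have g2 : y ^+ 2 <= y ^+ 3 by rewrite ler_weXn2l.
  have g3 : y <= y ^+ 3 by rewrite -[X in X <= _]expr1 ler_weXn2l.
  rewrite e4 f4 in h4; rewrite e3 f3 in h3; lra.
apply: (@le_trans _ _ (s * (n%:R ^+ 4 / 64 + 7 * n%:R ^+ 3) + 3 * (r%:R ^+ 4 * n%:R ^+ 3))).
  by rewrite lerD2r ler_wpM2l.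
have : s * n%:R ^+ 3 <= r%:R ^+ 4 * n%:R ^+ 3 by rewrite ler_wpM2r ?exprn_ge0.
rewrite mulrDr; lra.
Qed.

Lemma max_crossing_number_multipartite_ge (R : realType) (r n : nat) :
  r%:R * (r%:R - 1) * (r%:R ^+ 2 + r%:R - 3) / 24 * n%:R ^+ 4 - r%:R ^+ 3 * n%:R ^+ 3 <=
  (max_crossing_number R (balanced_multipartite r n))%:R :> R.
Proof.
have [_ ge] := @crossing_number_two_page R (balanced_multipartite r n) _ (fun=> false) (@blockwise_index_inj r n).
apply: le_trans (blockwise_quads_ge R r n) _.
by rewrite ler_nat.
Qed.

(** The limit superior is at most the supremum of any tail, and [e] is arbitrary. *)
Lemma limn_esup_le (R : realType) (u : (\bar R)^nat) (l : R) :
  (forall e : R, 0 < e -> \forall n \near \oo, (u n <= (l + e)%:E)%E) ->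
  (limn_esup u <= l%:E)%E.
Proof.
move=> h; apply/lee_addgt0Pr => e e0; have [N _ hN] := h e e0.
rewrite /limn_esup limf_esupE.
apply: (@le_trans _ _ (ereal_sup (u @` [set n | (N <= n)%N]))).
  by apply: ereal_inf_lbound; exists [set n | (N <= n)%N] => //; exists N.
by apply: ge_ereal_sup => _ [n /= Nn <-]; rewrite -EFinD; exact: hN.
Qed.

Theorem corollary1p8 (R : realType) (r : nat) (hr : (2 <= r)%N) :
  (limn_esup (fun n : nat =>
     ((crossing_number R (balanced_multipartite r n))%:R /
      (max_crossing_number R (balanced_multipartite r n))%:R : R)%:E)
   <= (zeta R r)%:E)%E.
Proof.
pose x : R := r%:R; have x2 : 2 <= x by rewrite ler_nat.
pose C := x * (x - 1) * (x ^+ 2 + x - 3) / 24.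
have q0 : 0 < x ^+ 2 + x - 3 by nra.
have C0 : 0 < C by rewrite divr_gt0 // !mulr_gt0 //; lra.
(* [C] is the leading coefficient of the lower bound on the denominator; its product with [zeta] is
   that of the upper bound on the numerator. *)
have zC : zeta R r * C = (x * (x - 1)) ^+ 2 / 64.
  rewrite /zeta /C -/x; field; lra.
have z0 : 0 <= zeta R r.
  rewrite /zeta -/x divr_ge0 ?mulr_ge0 //; [nra|lra].
apply: limn_esup_le => e e0.
near=> n.
have n0 : (0 < n)%N by near: n; exact: nbhs_infty_gt.
pose y : R := n%:R; have y0 : 0 < y by rewrite ltr0n.
(* This makes the lower bound on the denominator positive. *)
have big1 : x ^+ 3 + 1 <= C * y.
  rewrite [leRHS]mulrC -ler_pdivrMr // /y; near: n; exact: nbhs_infty_ger.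
have eC : 0 < e * C by exact: mulr_gt0.
(* After division by [y ^+ 3], this is what lets [e] absorb the lower-order terms of both bounds. *)
have big2 : 10 * x ^+ 4 + (zeta R r + e) * x ^+ 3 <= e * C * y.
  rewrite [leRHS]mulrC -ler_pdivrMr // /y; near: n; exact: nbhs_infty_ger.
have up := crossing_number_multipartite_le R r n0.
have lo := max_crossing_number_multipartite_ge R r n.
rewrite -/x -/y -/C in up lo; rewrite lee_fin.
have y3 : 0 < y ^+ 3 by rewrite exprn_gt0.
have fac : C * y ^+ 4 - x ^+ 3 * y ^+ 3 = y ^+ 3 * (C * y - x ^+ 3) by ring.
rewrite fac in lo.
have pos : 0 < y ^+ 3 * (C * y - x ^+ 3) by rewrite mulr_gt0 //; lra.
rewrite ler_pdivrMr; last exact: lt_le_trans lo.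
apply: le_trans up _; apply: le_trans (ler_wpM2l _ lo); last by lra.
have -> : (x * (x - 1)) ^+ 2 * (y ^+ 4 / 64) + 10 * x ^+ 4 * y ^+ 3 =
  y ^+ 3 * (zeta R r * C * y + 10 * x ^+ 4) by rewrite zC; field.
by rewrite [leRHS]mulrCA ler_pM2l //; lra.
Unshelve. all: by end_near.
Qed.
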